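(* Suppose a group $G$ acts on a wallspace $(X,\mathcal{W})$, where $X$ is also a metric space $(X,\mathsf{d})$, and the action of $G$ on $(X,\mathsf{d})$ is (isometric and) metrically proper. If $(X,\mathcal{W})$ has the Linear Separation Property, then $G$ acts metrically properly on the dual cube complex $C=C(X,\mathcal{W})$. More generally, $G$ acts metrically properly on $C$ provided that for some $x\in X$ we have $\#(x,gx)\to\infty$ as $g\to\infty$, i.e. for every $N$ the set $\{g\in G:\#(x,gx)\le N\}$ is finite.
   Context: A wall on a nonempty set $X$ is a pair $\{U,V\}$ of subsets (closed halfspaces) with $U\cup V=X$ (overlap allowed); its open halfspaces are $U\setminus V$ and $V\setminus U$. It separates $x,y$ if they lie in distinct open halfspaces; $\#(x,y)$ is the number of walls separating $x$ and $y$; $x$ betwixts the wall if $x\in U\cap V$. A wallspace $(X,\mathcal{W})$ is a set with an (indexed) collection of walls such that $\#(x,y)<\infty$ for all $x,y$ and each point betwixts finitely many walls. Distinct walls may have the same pair of halfspaces, except that two distinct walls may not be the same genuine partition $\{U,V\}$ with $U\cap V=\emptyset$ and $U,V\neq\emptyset$. A group acts on $(X,\mathcal{W})$ if it acts on $X$ and preserves $\mathcal{W}$. Linear Separation Property: there exist constants $\kappa>0$ and $\epsilon$ such that $\#(x,y)\ge\kappa\,\mathsf{d}(x,y)-\epsilon$ for all $x,y\in X$. Dual cube complex. An orientation $c(W)=(\overleftarrow{c}(W),\overrightarrow{c}(W))$ of a wall $W$ is an ordering of its two (indexed) halfspaces. A $0$-cube of $C(X,\mathcal{W})$ is a choice of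 orientation $c(W)$ for every wall such that (i) $\overleftarrow{c}(W)\cap\overleftarrow{c}(W')\neq\emptyset$ for all walls $W,W'$; (ii) for each $x\in X$, $x\in\overleftarrow{c}(W)$ for all but finitely many $W$. Two $0$-cubes are joined by a $1$-cube iff they differ on exactly one wall; for $n\ge2$ an $n$-cube is added whenever its $(n-1)$-skeleton is present. $G$ acts on $C$ by $\overleftarrow{gc}(gW)=g\overleftarrow{c}(W)$. Distances in $C$ are combinatorial: the distance between two $0$-cubes is their graph distance in the $1$-skeleton. An action of $G$ on a metric space $Z$ is metrically proper if for each $r>0$ and $z\in Z$ the set $\{g\in G: gB_r(z)\cap B_r(z)\neq\emptyset\}$ is finite. *)

(* Defs.v *)
From HB Require Import structures.
From mathcomp Require Import all_boot all_order all_algebra finmap.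
From mathcomp Require Import all_classical all_reals all_analysis.

Set Implicit Arguments.
Unset Strict Implicit.
Unset Printing Implicit Defensive.

Import Order.TTheory GRing.Theory Num.Theory.

Local Open Scope classical_set_scope.
Local Open Scope ring_scope.

(* [half w true] and [half w false] are the two closed halfspaces of the wall
   indexed by [w].  Both the walls and the two halfspaces of each wall are
   indexed: distinct indices may carry the same sets. *)
Section WallNotions.
Context {X : Type} {wall : choiceType} (half : wall -> bool -> set X).

Definition open_half (w : wall) (b : bool) : set X :=
  half w b `\` half w (~~ b).

Definition separates (w : wall) (x y : X) : Prop :=
  exists b, open_half w b x /\ open_half w (~~ b) y.

Definition betwixts (x : X) (w : wall) : Prop :=
  half w true x /\ half w false x.

Definition halfspaces (w : wall) : set (set X) :=
  [set half w true; half w false].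

Definition genuine (w : wall) : Prop :=
  [/\ half w true `&` half w false = set0,
      half w true !=set0 & half w false !=set0].

End WallNotions.

Record wallspace (X : Type) := Wallspace {
  wall : choiceType ;
  half : wall -> bool -> set X ;
  space_nonempty : [set: X] !=set0 ;
  half_cover : forall w, half w true `|` half w false = setT ;
  finite_separates : forall x y, finite_set [set w | separates half w x y] ;
  finite_betwixts : forall x, finite_set [set w | betwixts half x w] ;
  genuine_inj : forall w w', genuine half w ->
    halfspaces half w = halfspaces half w' -> w = w' }.

Definition nsep (X : Type) (W : wallspace X) (x y : X) : nat :=
  #|` fset_set [set w | separates (@half X W) w x y]|.

Definition linear_separation (R : realType) (X : metricType R)
    (W : wallspace X) : Prop :=
  exists kappa epsilon : R, 0 < kappa /\
    forall x y : X, kappa * mdist x y - epsilon <= (nsep W x y)%:R.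

Definition is_action (G : groupType) (Z : Type) (act : G -> Z -> Z) : Prop :=
  (forall z, act 1%g z = z) /\
  (forall g h z, act (g * h)%g z = act g (act h z)).

(* The collection of walls being indexed, an action comprises an action on the
   indices: [g] sends the wall [w] to [wact g w], and the halfspace [b] of [w]
   to the halfspace [lact g w b] of [wact g w].  The maps [lact] are determined
   by [pact] and [wact] for all walls whose two halfspaces are distinct sets. *)
Record wallspace_action (G : groupType) (X : Type) (W : wallspace X) :=
  WallspaceAction {
  pact : G -> X -> X ;
  pact_action : is_action pact ;
  wact : G -> wall W -> wall W ;
  wact_action : is_action wact ;
  lact : G -> wall W -> bool -> bool ;
  lact1 : forall w b, lact 1%g w b = b ;
  lactM : forall g h w b,
    lact (g * h)%g w b = lact g (wact h w) (lact h w b) ;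
  half_act : forall g w b, half (wact g w) (lact g w b) = pact g @` half w b }.

Section MetricallyProper.
Context {R : realType} {Z : Type} (d : Z -> Z -> R).

Definition dball (z : Z) (r : R) : set Z := [set y | d z y < r].

Definition isometric_action (G : groupType) (act : G -> Z -> Z) : Prop :=
  forall g x y, d (act g x) (act g y) = d x y.

Definition metrically_proper (G : groupType) (act : G -> Z -> Z) : Prop :=
  forall (r : R) (z : Z), 0 < r ->
    finite_set [set g : G | (act g @` dball z r) `&` dball z r !=set0].

End MetricallyProper.

(* An orientation of the wall [w] is encoded by the label [c w] of the first
   halfspace of the ordered pair [(half w (c w), half w (~~ c w))]. *)
Record zero_cube (X : Type) (W : wallspace X) := ZeroCube {
  orient :> wall W -> bool ;
  orient_meet : forall w w',
    half w (orient w) `&` half w' (orient w') !=set0 ;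
  orient_finite : forall x, finite_set [set w | ~ half w (orient w) x] }.

Section DualCubeComplex.
Context {X : Type} {W : wallspace X}.
Implicit Types c : zero_cube W.

Lemma zero_cube_eq c c' : c =1 c' -> c = c'.
Proof.
case: c c' => [q m f] [q' m' f'] /= /funext e; subst q'.
by congr ZeroCube; exact: Prop_irrelevance.
Qed.

Definition adjacent : rel (zero_cube W) :=
  fun c c' => `[< exists! w, c w <> c' w >].

(* [is_cube n f]: the parametrization [f] of the vertices of a combinatorial
   n-cube by {0,1}^n spans an n-cube of the dual complex.  For n >= 2 this
   holds exactly when all the codimension-1 faces are cubes of the complex. *)
Definition face (T : Type) n (f : {ffun 'I_n.+1 -> bool} -> T)
    (i : 'I_n.+1) (b : bool) : {ffun 'I_n -> bool} -> T :=
  fun u => f [ffun j => if unlift i j is Some k then u k else b].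

Fixpoint is_cube n : ({ffun 'I_n -> bool} -> zero_cube W) -> Prop :=
  match n with
  | 0 => fun _ => True
  | n'.+1 => fun f =>
    if n' is 0 then adjacent (f [ffun=> false]) (f [ffun=> true])
    else injective f /\ forall i b, is_cube (face f i b)
  end.

Lemma half_coverE (w : wall W) b x : ~ half w b x -> half w (~~ b) x.
Proof.
have : [set: X] x by [].
by rewrite -(half_cover w); case: b => -[].
Qed.

Lemma finite_differ c c' : finite_set [set w | c w <> c' w].
Proof.
have [x _] := space_nonempty W.
apply: (@sub_finite_set _ _ ([set w | betwixts (@half X W) x w] `|`
  ([set w | ~ half w (c w) x] `|` [set w | ~ half w (c' w) x]))).
  move=> w /= ne; apply: contrapT => /not_orP[nb /not_orP[/contrapT h /contrapT h']].
  by apply: nb; case: (c w) (c' w) ne h h' => -[].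
rewrite !finite_setU; do !split; [exact: finite_betwixts | exact: orient_finite..].
Qed.

Lemma ex_minimal (T : eqType) (lt : T -> T -> Prop) (s : seq T) (x0 : T) :
  (forall x, ~ lt x x) -> (forall x y z, lt x y -> lt y z -> lt x z) ->
  x0 \in s -> exists2 x, x \in s & forall y, y \in s -> ~ lt y x.
Proof.
move=> irr tr; elim: s x0 => // a [|b s] IH x0 _.
  by exists a; rewrite ?mem_head// => y; rewrite inE => /eqP ->.
have [x xs xm] := IH b (mem_head _ _).
have [ax|nax] := pselect (lt a x).
- exists a; rewrite ?mem_head// => y; rewrite inE => /predU1P[->//|ys ya].
  exact: xm y ys (tr _ _ _ ya ax).
- exists x; first by rewrite inE xs orbT.
  by move=> y; rewrite inE => /predU1P[->//|]; exact: xm.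
Qed.

Lemma flip_proof c c' w : c w <> c' w ->
  (forall v, c v <> c' v -> v <> w ->
     half w (c' w) `&` half v (c v) !=set0) ->
  exists2 c1, adjacent c c1 &
    forall v, c1 v = if v == w then c' w else c v.
Proof.
move=> ne meet.
pose o v := if v == w then c' w else c v.
have key v : v <> w -> half w (c' w) `&` half v (c v) !=set0.
  move=> vw; have [e|/meet] := pselect (c v = c' v); last exact.
  by rewrite e; exact: orient_meet.
have om v v' : half v (o v) `&` half v' (o v') !=set0.
  rewrite /o; case: (eqVneq v w) => [->|/eqP vw];
    case: (eqVneq v' w) => [->|/eqP vw'].
  - exact: orient_meet.
  - exact: key.
  - by rewrite setIC; exact: key.
  - exact: orient_meet.
have fo x : finite_set [set v | ~ half v (o v) x].
  apply: (@sub_finite_set _ _ ([set w] `|` [set v | ~ half v (c v) x])).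
    by move=> v /=; rewrite /o; case: eqVneq => [->|_]; [left|right].
  by rewrite finite_setU; split; [exact: finite_set1|exact: orient_finite].
exists (ZeroCube om fo) => //; apply/asboolP; exists w.
split=> [|v]; rewrite /= /o; first by rewrite eqxx.
by case: eqVneq.
Qed.

Lemma connected_seq n c c' (s : seq (wall W)) : (size s <= n)%N ->
  (forall w, c w <> c' w <-> w \in s) ->
  exists2 p, path adjacent c p & last c p = c'.
Proof.
elim: n c s => [|n IH] c s sn sD.
  exists [::] => //=; apply: zero_cube_eq => w; apply: contrapT => /sD.
  by move: sn; rewrite leqn0 => /nilP ->.
case: s sn sD => [|w0 s'] sn sD.
  by exists [::] => //=; apply: zero_cube_eq => w; apply: contrapT => /sD.
set s := w0 :: s' in sn sD.
pose lt v w := half v (c v) `<` half w (c w) \/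
  (half v (c v) = half w (c w) /\ half w (c' w) `<` half v (c' v)).
have irr v : ~ lt v v by rewrite /lt => -[[] //|[_ []] //].
have tr x y z : lt x y -> lt y z -> lt x z.
  move=> [xy|[xy xy']] [yz|[yz yz']]; rewrite /lt.
  - left; case: xy yz => a b [a' b']; split; first exact: subset_trans a a'.
    by move=> h; apply: b'; exact: subset_trans h a.
  - by left; rewrite -yz.
  - by left; rewrite xy.
  - right; split; first by rewrite xy.
    case: xy' yz' => a b [a' b']; split; first exact: subset_trans a' a.
    by move=> h; apply: b'; exact: subset_trans a h.
have [w ws wm] := ex_minimal irr tr (mem_head w0 s' : w0 \in s).
have neg v : v \in s -> c' v = ~~ c v.
  by move=> /sD; case: (c v) (c' v) => -[].
have /flip_proof-/(_ _)[|c1 cc1 c1E] : c w <> c' w by apply/sD.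
  move=> v /sD vs vw; apply: contrapT => /set0P/negP/negPn/eqP dis.
  have vsubw : half v (c v) `<=` half w (c w).
    move=> x vx; apply: contrapT => /half_coverE; rewrite -neg// => wx.
    by have : set0 x by rewrite -dis.
  have wv : half w (c w) `<=` half v (c v).
    by apply: contrapT => nwv; apply: (wm v vs); left; split.
  have vwE : half v (c v) = half w (c w) by apply/seteqP.
  have w'v' : half w (c' w) `<=` half v (c' v).
    move=> x wx; rewrite neg//; apply: half_coverE => vx.
    by have : set0 x by rewrite -dis.
  have v'w' : half v (c' v) `<=` half w (c' w).
    by apply: contrapT => n'; apply: (wm v vs); right; split=> //; split.
  have vwE' : half v (c' v) = half w (c' w) by apply/seteqP.
  have hsE u : u \in s ->
      halfspaces (@half X W) u = [set half u (c u); half u (c' u)].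
    by move=> us; rewrite /halfspaces neg//; case: (c u); rewrite //= setUC.
  apply: vw; apply: esym; apply: genuine_inj.
    have ne (c2 : zero_cube W) u : half u (c2 u) !=set0.
      by have [x []] := orient_meet c2 u u; exists x.
    have := ne c w; have := ne c' w; move: dis.
    by rewrite vwE neg//; case: (c w) => /= dis a b; split=> //; rewrite setIC.
  by rewrite !hsE// vwE vwE'.
have wc1 : c1 w = c' w by rewrite c1E eqxx.
have [||p pp lp] := IH c1 (rem w (undup s)).
- rewrite size_rem ?mem_undup//; have := size_undup s; move: ws.
  rewrite -mem_undup; case: (undup s) => //= a l _ le.
  by rewrite -ltnS; exact: leq_trans le sn.
- move=> v; rewrite (rem_filter w (undup_uniq s)) mem_filter mem_undup /=.
  case: (eqVneq v w) => [->|/eqP vw] /=; first by rewrite wc1; split.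
  by rewrite c1E; case: eqVneq.
by exists (c1 :: p) => //=; rewrite cc1.
Qed.

Lemma walk_exists c c' : exists n,
  `[< exists p, [/\ path adjacent c p, last c p = c' & size p = n] >].
Proof.
have [s sE] := (finite_seqP _).1 (finite_differ c c').
have [|p pp lp] := @connected_seq (size s) c c' s (leqnn _).
  by move=> w; rewrite -[c w <> c' w]/([set v | c v <> c' v] w) sE.
by exists (size p); apply/asboolP; exists p.
Qed.

(* graph distance in the 1-skeleton: the least length of an edge path *)
Definition cube_dist c c' : nat := ex_minn (walk_exists c c').

End DualCubeComplex.

Section DualAction.
Context {G : groupType} {X : Type} {W : wallspace X}.
Variable A : wallspace_action G W.
Implicit Types c : zero_cube W.

Lemma wactVK g : cancel (wact A g^-1%g) (wact A g).
Proof. by case: (wact_action A) => w1 wM w; rewrite -wM mulgV w1. Qed.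

Lemma wactK g : cancel (wact A g) (wact A g^-1%g).
Proof. by case: (wact_action A) => w1 wM w; rewrite -wM mulVg w1. Qed.

Lemma pactVK g : cancel (pact A g^-1%g) (pact A g).
Proof. by case: (pact_action A) => p1 pM x; rewrite -pM mulgV p1. Qed.

Lemma lactK g w : cancel (lact A g w) (lact A g^-1%g (wact A g w)).
Proof. by move=> b; rewrite -lactM mulVg lact1. Qed.

(* the halfspace chosen by [g c] on [g w] is the [g]-image of the one chosen by
   [c] on [w] *)
Definition act_orient (g : G) (c : wall W -> bool) (w : wall W) : bool :=
  lact A g (wact A g^-1%g w) (c (wact A g^-1%g w)).

Lemma act_orientE g (c : wall W -> bool) w :
  act_orient g c (wact A g w) = lact A g w (c w).
Proof. by rewrite /act_orient wactK. Qed.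

Lemma half_act_orient g (c : wall W -> bool) w :
  half w (act_orient g c w) =
  pact A g @` half (wact A g^-1%g w) (c (wact A g^-1%g w)).
Proof. by rewrite -half_act wactVK. Qed.

Lemma act_meet g c w w' :
  half w (act_orient g c w) `&` half w' (act_orient g c w') !=set0.
Proof.
rewrite !half_act_orient.
have [x [h h']] := orient_meet c (wact A g^-1%g w) (wact A g^-1%g w').
by exists (pact A g x); split; exists x.
Qed.

Lemma act_finite g c x : finite_set [set w | ~ half w (act_orient g c w) x].
Proof.
have := finite_image (wact A g) (orient_finite c (pact A g^-1%g x)).
apply: sub_finite_set => w /= nw; exists (wact A g^-1%g w); last exact: wactVK.
move=> /= h; apply: nw; rewrite half_act_orient.
by exists (pact A g^-1%g x) => //; exact: pactVK.
Qed.

Definition cube_act (g : G) c : zero_cube W :=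
  ZeroCube (act_meet g c) (act_finite g c).

Lemma cube_act_action : is_action cube_act.
Proof.
have [w1 wM] := wact_action A.
split=> [c|g h c]; apply: zero_cube_eq => w /=.
  by rewrite /act_orient lact1 invg1 w1.
by rewrite /act_orient lactM invgM !wM wactVK.
Qed.

Lemma cube_act_adjacent g c c' :
  adjacent c c' -> adjacent (cube_act g c) (cube_act g c').
Proof.
move=> /asboolP[w [/= ne uw]]; apply/asboolP; exists (wact A g w); split=> /=.
  by rewrite !act_orientE => /(can_inj (lactK g w)).
move=> v /= nv; rewrite (uw (wact A g^-1%g v)) ?wactVK// => e.
by apply: nv; rewrite /act_orient e.
Qed.

Lemma cube_act_inj g : injective (cube_act g).
Proof.
have [a1 aM] := cube_act_action.
by apply: (@can_inj _ _ _ (cube_act g^-1%g)) => c; rewrite -aM mulVg a1.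
Qed.

Lemma cube_act_cube g n (f : {ffun 'I_n -> bool} -> zero_cube W) :
  is_cube f -> is_cube (cube_act g \o f).
Proof.
elim: n f => // -[_ f /=|n IH f [fi ff]]; first exact: cube_act_adjacent.
split=> [u v /cube_act_inj/fi //|i b].
exact: IH (ff i b).
Qed.

Lemma cube_act_isometric g c c' :
  cube_dist (cube_act g c) (cube_act g c') = cube_dist c c'.
Proof.
have le h d d' : (cube_dist (cube_act h d) (cube_act h d') <= cube_dist d d')%N.
  rewrite {1}/cube_dist; case: ex_minnP => m _; apply.
  rewrite /cube_dist; case: ex_minnP => k /asboolP[p [pp pl <-]] _.
  apply/asboolP; exists (map (cube_act h) p).
  rewrite last_map pl size_map path_map; split=> //.
  by apply: sub_path pp => u v; exact: cube_act_adjacent.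
have [a1 aM] := cube_act_action.
apply/eqP; rewrite eqn_leq le /=.
by have := le g^-1%g (cube_act g c) (cube_act g c'); rewrite -!aM mulVg !a1.
Qed.

End DualAction.

(* Metric properness of the action on the dual cube complex, with the
   combinatorial metric, which is the graph metric on the 0-cubes. *)
Definition metrically_proper_on_dual (R : realType) (G : groupType) (X : Type)
    (W : wallspace X) (A : wallspace_action G W) : Prop :=
  metrically_proper (fun c c' : zero_cube W => (cube_dist c c')%:R : R)
    (cube_act A).

(* Main.v *)
From Pilot Require Import Defs.
From mathcomp Require Import all_boot all_order all_algebra.
From mathcomp Require Import finmap.
From mathcomp Require Import all_classical all_reals all_analysis.

(** Fix a point [x] and a 0-cube [c], and let [k] be the number of walls [w]
    with [x] outside the halfspace [c w].  By equivariance [g x] also lies outside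
    exactly [k] of the halfspaces chosen by [g c].  A wall separating [x] from
    [g x] that is not one of these [k + k] walls is oriented by [c] towards [x]
    and by [g c] towards [g x], hence [c] and [g c] differ on it.  Therefore
    [#(x, g x) <= d(c, g c) + 2 k], and only finitely many [g] move [c] a bounded
    distance. *)

Local Open Scope classical_set_scope.
Local Open Scope ring_scope.

Import Order.TTheory GRing.Theory Num.Theory.
(* The library exports its own [half] and [adjacent]. *)
Import Pilot.Defs.

Section CubeDistance.
Context {X : Type} {W : wallspace X}.
Implicit Types c : zero_cube W.

Lemma cube_dist_walk c c' :
  exists p, [/\ path adjacent c p, last c p = c' & size p = cube_dist c c'].
Proof. by rewrite /cube_dist; case: ex_minnP => n /asboolP. Qed.

Lemma cube_dist_le c p :
  path adjacent c p -> (cube_dist c (last c p) <= size p)%N.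
Proof.
move=> cp; rewrite /cube_dist; case: ex_minnP => n _; apply.
by apply/asboolP; exists p.
Qed.

Lemma adjacent_sym c c' : adjacent c c' -> adjacent c' c.
Proof.
move=> /asboolP[w [ne uw]]; apply/asboolP; exists w; split; first exact: nesym.
by move=> v /nesym/uw.
Qed.

Lemma cube_dist_triangle c1 c2 c3 :
  (cube_dist c1 c3 <= cube_dist c1 c2 + cube_dist c2 c3)%N.
Proof.
have [p [cp lp <-]] := cube_dist_walk c1 c2.
have [q [cq lq <-]] := cube_dist_walk c2 c3.
by rewrite -size_cat -lq -lp -last_cat cube_dist_le// cat_path cp lp.
Qed.

Lemma cube_dist_sym c c' : cube_dist c c' = cube_dist c' c.
Proof.
suff le (d d' : zero_cube W) : (cube_dist d d' <= cube_dist d' d)%N.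
  by apply/eqP; rewrite eqn_leq !le.
have [p [dp lp <-]] := cube_dist_walk d' d.
(* The path is walked backwards: [belast] drops its end [d], now the start, and keeps [d'], now the
   end. *)
have e : last d (rev (belast d' p)) = d'.
  by case: p lp {dp} => //= a p _; rewrite rev_cons last_rcons.
rewrite -(size_belast d') -size_rev -[X in cube_dist _ X]e cube_dist_le//.
rewrite -lp rev_path.
by apply: sub_path dp => a b; exact: adjacent_sym.
Qed.

(** Each edge changes the orientation of a single wall; [s] lists these walls, one per edge,
    possibly with repetitions. *)
Lemma path_differ c p : path adjacent c p ->
  exists2 s : seq (wall W), size s = size p &
    forall w, c w <> last c p w -> w \in s.
Proof.
elim: p c => [|a p IH] c /=; first by exists [::].
move=> /andP[/asboolP[v [_ uv]] /IH[s <- sP]]; exists (v :: s) => // w ne.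
rewrite inE; have [/uv ->|/contrapT e] := pselect (c w <> a w).
  by rewrite eqxx.
by rewrite sP ?orbT// -e.
Qed.

Lemma nsep_le_size (s : seq (wall W)) x y :
  (forall w, separates (@half X W) w x y -> w \in s) -> (nsep W x y <= size s)%N.
Proof.
move=> sP; rewrite /nsep; apply: uniq_leq_size; first exact: fset_uniq.
move=> w; rewrite in_fset_set; last exact: finite_separates.
by rewrite inE; exact: sP.
Qed.

(** Only one halfspace of [w] contains [x], and only the other contains [y], so choosing correctly
    for both points forces different labels. *)
Lemma separates_orient c c' w x y : separates (@half X W) w x y ->
  [\/ ~ half w (c w) x, ~ half w (c' w) y | c w <> c' w].
Proof.
case=> b [[_ nx] [_ ny]]; have [cb|] := eqVneq (c w) b; last first.
  by move=> ne; apply: Or31; case: (c w) b ne nx {ny} => -[].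
have [cb'|] := eqVneq (c' w) (~~ b).
  by apply: Or33; rewrite cb cb'; case: (b).
by move=> ne; apply: Or32; case: (c' w) b ne ny {nx cb} => -[].
Qed.

End CubeDistance.

Section Properness.
Context {G : groupType} {X : Type} {W : wallspace X}.
Variable A : wallspace_action G W.
Implicit Types c : zero_cube W.

Lemma act_orient_outside g c x w :
  ~ half w (cube_act A g c w) (pact A g x) ->
  ~ half (wact A g^-1%g w) (c (wact A g^-1%g w)) x.
Proof.
by move=> nw h; apply: nw; rewrite half_act_orient; exists x.
Qed.

Lemma nsep_le_cube_dist c x : exists k, forall g,
  (nsep W x (pact A g x) <= cube_dist c (cube_act A g c) + k)%N.
Proof.
have [t tE] := (finite_seqP _).1 (orient_finite c x).
have tP w : ~ half w (c w) x -> w \in t.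
  by rewrite -[~ _]/([set w | ~ half w (c w) x] w) tE.
exists (size t + size t)%N => g.
have [p [cp lp <-]] := cube_dist_walk c (cube_act A g c).
have [s <- sP] := path_differ _ _ cp.
(* The second [size t] counts the [g]-translates of the walls in [t]: among them are all walls whose
   halfspace in [g c] misses [g x]. *)
rewrite -{2}(size_map (wact A g) t) -!size_cat; apply: nsep_le_size => w.
rewrite !mem_cat => /(separates_orient c (cube_act A g c))[/tP -> | | ne].
- by rewrite orbT.
- move=> /act_orient_outside/tP wt; apply/orP; right; apply/orP; right.
  by apply/mapP; exists (wact A g^-1%g w); rewrite ?wactVK.
- by rewrite sP// lp.
Qed.

Lemma metrically_proper_on_dual_nsep (R : realType) x :
  (forall N, finite_set [set g : G | (nsep W x (pact A g x) <= N)%N]) ->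
  metrically_proper_on_dual R A.
Proof.
move=> fin r c r0; have [k kP] := nsep_le_cube_dist c x.
pose M := Num.bound r.
have ltM n : n%:R < r -> (n <= M)%N.
  move=> nr; rewrite -(ler_nat R); apply: ltW; apply: lt_trans nr _.
  exact: archi_boundP (ltW r0).
(* Both [c'] and [g c'] lie within [M] of [c], so passing from [c] to [g c] through [g c'] costs at
   most [M + M]. *)
apply: sub_finite_set (fin (M + M + k)%N) => g /= [_ [[c' /ltM h <-] /ltM h']].
apply: leq_trans (kP g) _; rewrite leq_add2r.
apply: leq_trans (cube_dist_triangle c (cube_act A g c') _) _.
by rewrite leq_add// cube_act_isometric cube_dist_sym.
Qed.

End Properness.

(** Linear separation turns the bound [N] on separating walls into the bound [(N + eps) / kappa] on
    the distance from [x] to [g x]. *)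
Lemma linear_separation_finite_nsep (R : realType) (G : groupType)
    (X : metricType R) (W : wallspace X) (A : wallspace_action G W) x N :
  metrically_proper (@mdist R X) (pact A) -> linear_separation W ->
  finite_set [set g : G | (nsep W x (pact A g x) <= N)%N].
Proof.
move=> prop [kappa [eps [k0 sep]]].
(* Since [eps] may be negative, the absolute value keeps [r] positive; adding 1 gives the strict
   inequality that open balls require. *)
pose r := `|(N%:R + eps) / kappa| + 1 : R.
have r0 : 0 < r by rewrite ltr_wpDl.
apply: sub_finite_set (prop r x r0) => g /= leN.
exists (pact A g x); split; first by exists x; rewrite // /dball /= mdistxx.
rewrite /dball /=; apply: (@le_lt_trans _ _ ((N%:R + eps) / kappa)).
  rewrite ler_pdivlMr// mulrC -lerBlDr; apply: le_trans (sep _ _) _.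
  by rewrite ler_nat.
by rewrite (le_lt_trans (ler_norm _))// ltrDl.
Qed.

Theorem theorem1p4 (R : realType) (G : groupType) :
  (forall (X : metricType R) (W : wallspace X) (A : wallspace_action G W),
     isometric_action (@mdist R X) (pact A) ->
     metrically_proper (@mdist R X) (pact A) ->
     linear_separation W ->
     metrically_proper_on_dual R A) /\
  (forall (X : Type) (W : wallspace X) (A : wallspace_action G W),
     (exists x : X, forall N : nat,
        finite_set [set g : G | (nsep W x (pact A g x) <= N)%N]) ->
     metrically_proper_on_dual R A).
Proof.
split=> [X W A _ prop sep | X W A [x]]; last first.
  exact: metrically_proper_on_dual_nsep.
have [x _] := space_nonempty W.
apply: (metrically_proper_on_dual_nsep A R x) => N.
exact: linear_separation_finite_nsep.
Qed.
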